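(* The logic $\mathcal L(2^e,\bar 2^e)$ corresponding to the variety $\mathbb V(\mathbf{2^e},\mathbf{\bar 2^e})$ is defined, as an axiomatic extension of the logic $\mathcal{DQDSH}$, by the axiom $({\sim}\phi\to\bot)\Leftrightarrow_H\phi$.
   Context: Language: $\langle\vee,\wedge,\to,\sim,\bot,\top\rangle$ of arities $2,2,2,1,0,0$. $\alpha\to_H\beta$ abbreviates $\alpha\to(\alpha\wedge\beta)$ and $\alpha\Leftrightarrow_H\beta$ abbreviates $(\alpha\to_H\beta)\wedge(\beta\to_H\alpha)$. The logic $\mathcal{DHMSH}$ is the Hilbert-style logic with axiom schemes: (A1) $\alpha\to_H(\alpha\vee\beta)$; (A2) $\beta\to_H(\alpha\vee\beta)$; (A3) $(\alpha\to_H\gamma)\to_H[(\beta\to_H\gamma)\to_H((\alpha\vee\beta)\to_H\gamma)]$; (A4) $(\alpha\wedge\beta)\to_H\alpha$; (A5) $(\gamma\to_H\alpha)\to_H[(\gamma\to_H\beta)\to_H(\gamma\to_H(\alpha\wedge\beta))]$; (A6) $\top$; (A7) $\bot\to_H\alpha$; (A8) $((\alpha\wedge\beta)\to_H\gamma)\to_H(\alpha\to_H(\beta\to_H\gamma))$; (A9) $(\alpha\to_H(\beta\to_H\gamma))\to_H((\alpha\wedge\beta)\to_H\gamma)$; (A10) $(\alpha\to_H\beta)\to_H((\beta\to_H\alpha)\to_H((\alpha\to\gamma)\to_H(\beta\to\gamma)))$; (A11) $(\alpha\to_H\beta)\to_H((\beta\to_H\alpha)\to_H((\gamma\to\beta)\to_H(\gamma\to\alpha)))$;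 (A12) $\top\to_H{\sim}\bot$; (A13) ${\sim}\top\to_H\bot$; (A14) ${\sim}(\alpha\wedge\beta)\to_H({\sim}\alpha\vee{\sim}\beta)$; and rules (SMP): from $\phi$ and $\phi\to_H\gamma$ deduce $\gamma$; (SCP): from $\phi\to_H\gamma$ deduce ${\sim}\gamma\to_H{\sim}\phi$ (both applicable to any formulas derived from the premises). An axiomatic extension is obtained by adjoining new axiom schemes and keeping the same rules. The logic $\mathcal{DQDSH}$ is the axiomatic extension of $\mathcal{DHMSH}$ by ${\sim}{\sim}(\alpha\vee\beta)\to_H({\sim}{\sim}\alpha\vee{\sim}{\sim}\beta)$; $({\sim}{\sim}\alpha\vee{\sim}{\sim}\beta)\to_H{\sim}{\sim}(\alpha\vee\beta)$; ${\sim}{\sim}{\sim}\alpha\to_H{\sim}\alpha$; ${\sim}\alpha\to_H{\sim}{\sim}{\sim}\alpha$; ${\sim}{\sim}\alpha\to_H\alpha$. A semi-Heyting algebra is an algebra $\langle L,\vee,\wedge,\to,0,1\rangle$ such that $\langle L,\vee,\wedge,0,1\rangle$ is a lattice with $0$ and $1$, and $x\wedge(x\to y)\approx x\wedge y$, $x\wedge(y\to z)\approx x\wedge[(x\wedge y)\to(x\wedge z)]$, $x\to x\approx1$. $\mathbb{DHMSH}$ is the variety of algebras $\langle A,\vee,\wedge,\to,{}',0,1\rangle$ such that $\langle A,\vee,\wedge,\to,0,1\rangle$ is a semi-Heyting algebra and $0'\approx1$, $1'\approx0$, $(x\wedge y)'\approx x'\vee y'$. Formulas are interpreted with $\sim,\bot,\top$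 as ${}',0,1$. The logic corresponding to a subvariety $\mathbb V$ of $\mathbb{DHMSH}$ is the unique axiomatic extension $\mathcal E$ of $\mathcal{DHMSH}$ such that $\mathbb V=\{\mathbf A\in\mathbb{DHMSH}:\mathbf A\models\delta\approx1\text{ for every theorem }\delta\text{ of }\mathcal E\}$; $\mathbb V$ is then the equivalent algebraic semantics of $\mathcal E$. $\mathbf{2^e}$ and $\mathbf{\bar 2^e}$ are the algebras on the two-element lattice $0<1$ with $0'=1$, $1'=0$; in $\mathbf{2^e}$: $0\to0=0\to1=1\to1=1$, $1\to0=0$; in $\mathbf{\bar 2^e}$: $0\to0=1\to1=1$, $0\to1=1\to0=0$. $\mathbb V(\cdot)$ denotes the generated variety. *)

(* Defs.v *)
From mathcomp Require Import all_boot.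

Set Implicit Arguments.
Unset Strict Implicit.
Unset Printing Implicit Defensive.

Inductive formula : Type :=
| Var of nat
| Or of formula & formula
| And of formula & formula
| Imp of formula & formula
| Neg of formula
| Bot
| Top.

Declare Scope formula_scope.
Delimit Scope formula_scope with F.
Bind Scope formula_scope with formula.

Notation "a ∨ b" := (Or a b) (at level 50, left associativity) : formula_scope.
Notation "a ∧ b" := (And a b) (at level 40, left associativity) : formula_scope.
Notation "a → b" := (Imp a b) (at level 55, right associativity) : formula_scope.
Notation "∼ a" := (Neg a) (at level 35, right associativity) : formula_scope.
Notation "⊥" := Bot : formula_scope.
Notation "⊤" := Top : formula_scope.

Definition ImpH (a b : formula) : formula := (a → (a ∧ b))%F.
Notation "a →H b" := (ImpH a b) (at level 55, right associativity) : formula_scope.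

Definition IffH (a b : formula) : formula := ((a →H b) ∧ (b →H a))%F.
Notation "a ⇔H b" := (IffH a b) (at level 56, no associativity) : formula_scope.

Fixpoint subst (s : nat -> formula) (a : formula) : formula :=
  match a with
  | Var n => s n
  | Or a b => Or (subst s a) (subst s b)
  | And a b => And (subst s a) (subst s b)
  | Imp a b => Imp (subst s a) (subst s b)
  | Neg a => Neg (subst s a)
  | Bot => Bot
  | Top => Top
  end.

(* An axiom scheme is written as a formula whose variables play the role of
   the metavariables; the axioms are its substitution instances. *)
Definition schemes := formula -> Prop.

Definition instance_of (S : schemes) (a : formula) : Prop :=
  exists b s, S b /\ a = subst s b.

Definition adjoin (S T : schemes) : schemes := fun a => S a \/ T a.

Definition logic := (formula -> Prop) -> formula -> Prop.

(* [scp] applies to everything derived from the premises, not only to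
   theorems. *)
Inductive hilbert (S : schemes) (G : formula -> Prop) : formula -> Prop :=
| hyp a : G a -> hilbert S G a
| ax a : instance_of S a -> hilbert S G a
| smp a b : hilbert S G a -> hilbert S G (a →H b)%F -> hilbert S G b
| scp a b : hilbert S G (a →H b)%F -> hilbert S G (∼ b →H ∼ a)%F.

Definition theorem_of (L : logic) (a : formula) : Prop := L (fun _ => False) a.

Definition same_logic (L M : logic) : Prop := forall G a, L G a <-> M G a.

Definition axiomatic_extension (S : schemes) (L : logic) : Prop :=
  exists T : schemes, same_logic L (hilbert (adjoin S T)).

Section Schemes.

Local Notation α := (Var 0).
Local Notation β := (Var 1).
Local Notation γ := (Var 2).
Local Open Scope formula_scope.

Inductive DHMSH_schemes : schemes :=
| A1 : DHMSH_schemes (α →H (α ∨ β))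
| A2 : DHMSH_schemes (β →H (α ∨ β))
| A3 : DHMSH_schemes ((α →H γ) →H ((β →H γ) →H ((α ∨ β) →H γ)))
| A4 : DHMSH_schemes ((α ∧ β) →H α)
| A5 : DHMSH_schemes ((γ →H α) →H ((γ →H β) →H (γ →H (α ∧ β))))
| A6 : DHMSH_schemes ⊤
| A7 : DHMSH_schemes (⊥ →H α)
| A8 : DHMSH_schemes (((α ∧ β) →H γ) →H (α →H (β →H γ)))
| A9 : DHMSH_schemes ((α →H (β →H γ)) →H ((α ∧ β) →H γ))
| A10 : DHMSH_schemes ((α →H β) →H ((β →H α) →H ((α → γ) →H (β → γ))))
| A11 : DHMSH_schemes ((α →H β) →H ((β →H α) →H ((γ → β) →H (γ → α))))
| A12 : DHMSH_schemes (⊤ →H (∼ ⊥))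
| A13 : DHMSH_schemes ((∼ ⊤) →H ⊥)
| A14 : DHMSH_schemes ((∼ (α ∧ β)) →H ((∼ α) ∨ (∼ β))).

Inductive DQD_schemes : schemes :=
| dqd1 : DQD_schemes ((∼ ∼ (α ∨ β)) →H ((∼ ∼ α) ∨ (∼ ∼ β)))
| dqd2 : DQD_schemes (((∼ ∼ α) ∨ (∼ ∼ β)) →H (∼ ∼ (α ∨ β)))
| dqd3 : DQD_schemes ((∼ ∼ ∼ α) →H (∼ α))
| dqd4 : DQD_schemes ((∼ α) →H (∼ ∼ ∼ α))
| dqd5 : DQD_schemes ((∼ ∼ α) →H α).

Definition DQDSH_schemes : schemes := adjoin DHMSH_schemes DQD_schemes.

Inductive boolean_scheme : schemes :=
| boolean_ax : boolean_scheme (((∼ α) → ⊥) ⇔H α).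

End Schemes.

Record algebra : Type := Algebra {
  carrier :> Type;
  join : carrier -> carrier -> carrier;
  meet : carrier -> carrier -> carrier;
  imp : carrier -> carrier -> carrier;
  neg : carrier -> carrier;
  zero : carrier;
  one : carrier
}.

Arguments join {a}.
Arguments meet {a}.
Arguments imp {a}.
Arguments neg {a}.
Arguments zero {a}.
Arguments one {a}.

Definition bounded_lattice (A : algebra) : Prop :=
  [/\ [/\ commutative (@join A), associative (@join A)
        & forall x y : A, join x (meet x y) = x],
      [/\ commutative (@meet A), associative (@meet A)
        & forall x y : A, meet x (join x y) = x]
    & left_id zero (@join A) /\ left_id one (@meet A)].

Definition semi_heyting (A : algebra) : Prop :=
  [/\ bounded_lattice A,
      forall x y : A, meet x (imp x y) = meet x y,
      forall x y z : A,
        meet x (imp y z) = meet x (imp (meet x y) (meet x z))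
    & forall x : A, imp x x = one].

Definition DHMSH (A : algebra) : Prop :=
  [/\ semi_heyting A,
      neg (zero : A) = one,
      neg (one : A) = zero
    & forall x y : A, neg (meet x y) = join (neg x) (neg y)].

Fixpoint eval (A : algebra) (v : nat -> A) (a : formula) : A :=
  match a with
  | Var n => v n
  | Or a b => join (eval v a) (eval v b)
  | And a b => meet (eval v a) (eval v b)
  | Imp a b => imp (eval v a) (eval v b)
  | Neg a => neg (eval v a)
  | Bot => zero
  | Top => one
  end.

Definition satisfies_one (A : algebra) (a : formula) : Prop :=
  forall v : nat -> A, eval v a = one.

Definition models (L : logic) (A : algebra) : Prop :=
  DHMSH A /\ forall a, theorem_of L a -> satisfies_one A a.

Definition same_class (V W : algebra -> Prop) : Prop := forall A, V A <-> W A.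

(* "The unique axiomatic extension with models [V]" is a definite description,
   so uniqueness is part of the definition. *)
Definition corresponding_logic (V : algebra -> Prop) (L : logic) : Prop :=
  [/\ axiomatic_extension DHMSH_schemes L,
      same_class V (models L)
    & forall M : logic, axiomatic_extension DHMSH_schemes M ->
        same_class V (models M) -> same_logic M L].

Definition hom (A B : algebra) (f : A -> B) : Prop :=
  [/\ {morph f : x y / join x y >-> join x y},
      {morph f : x y / meet x y >-> meet x y},
      {morph f : x y / imp x y >-> imp x y},
      {morph f : x / neg x >-> neg x}
    & f zero = zero /\ f one = one].

Definition product_algebra (I : Type) (B : I -> algebra) : algebra :=
  @Algebra (forall i, B i)
    (fun x y i => join (x i) (y i)) (fun x y i => meet (x i) (y i))
    (fun x y i => imp (x i) (y i)) (fun x i => neg (x i))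
    (fun i => zero) (fun i => one).

(* Subalgebras are taken up to isomorphism, as embedded algebras. *)
Definition variety (V : algebra -> Prop) : Prop :=
  [/\ forall (A B : algebra) (f : A -> B),
        V A -> hom f -> (forall y, exists x, f x = y) -> V B,
      forall (A B : algebra) (f : B -> A),
        V A -> hom f -> injective f -> V B
    & forall (I : Type) (B : I -> algebra),
        (forall i, V (B i)) -> V (product_algebra B)].

Definition generated_variety (K : algebra -> Prop) (A : algebra) : Prop :=
  forall V : algebra -> Prop, variety V -> (forall B, K B -> V B) -> V A.

Definition two_e : algebra :=
  @Algebra bool orb andb (fun x y => x ==> y) negb false true.

Definition two_bar_e : algebra :=
  @Algebra bool orb andb (fun x y => x == y) negb false true.

Definition two_element_pair (A : algebra) : Prop :=
  A = two_e \/ A = two_bar_e.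

(* Main.v *)
From HB Require Import structures.
From mathcomp Require Import all_boot.
From mathcomp Require Import boolp classical_sets.
Require Import Defs.

(** Two facts make up the result.

    - Adjoining the axiom forces Boolean algebras.  In a member of [DHMSH] write
      [x*] for [x -> 0], which is the pseudocomplement of [x].  The axiom says
      [x'* = x], so every element is a pseudocomplement, [x** = x], and hence
      [x* = x'** = x'] ([neg_pseudo]).  Thus [x'] is a Boolean complement, and
      distinct elements are separated by ultrafilters
      ([ultrafilter_separation], by Zorn).  In a Boolean semi-Heyting algebra
      an ultrafilter [h] determines [h (x -> y)] from [h x], [h y] and
      [h (0 -> 1)] ([ultrafilter_imp]), so [h] is a homomorphism to one of the
      two two-element algebras.  The algebra therefore embeds in a product
      of copies of them ([boolean_generated]).  Conversely the two algebras satisfy all the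
      axioms, and identities are inherited by the generated variety
      ([generated_models]).

    - An axiomatic extension of the base logic is determined by its models
      ([same_models_same_logic]).  The formulas modulo provable
      equivalence form an algebra of [DHMSH] ([lindenbaum_DHMSH]) in which
      exactly the theorems are identically [1], so a formula that is
      identically [1] in every model is a theorem; and two Hilbert systems with
      the same rules and the same theorems have the same consequences
      ([sub_hilbert]). *)

Set Implicit Arguments.
Unset Strict Implicit.
Unset Printing Implicit Defensive.

(** * Derivations in extensions of the base logic *)

(* Classical choice on formulas, as required to form quotients of [formula]. *)
HB.instance Definition _ := gen_eqMixin formula.
HB.instance Definition _ := gen_choiceMixin formula.

Section Derivations.
Variables (S : schemes) (G : formula -> Prop).
Hypothesis subS : forall a, DHMSH_schemes a -> S a.
Local Open Scope quotient_scope.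
Local Open Scope formula_scope.
Implicit Types a b c d : formula.

Local Notation "⊢ a" := (hilbert S G a) (at level 70).

(** Only the metavariables with indices 0, 1 and 2 occur in the schemes. *)
Definition three (a b c : formula) (n : nat) : formula :=
  match n with 0 => a | 1 => b | _ => c end.

Lemma derivable_axiom t a b c : DHMSH_schemes t -> ⊢ subst (three a b c) t.
Proof. by move=> tS; apply: ax; exists t, (three a b c); split=> //; exact: subS. Qed.

(** The order of the Lindenbaum algebra. *)
Definition entails a b := ⊢ a →H b.
Local Notation "a ≼ b" := (entails a b) (at level 70).

Lemma orl a b : a ≼ a ∨ b. Proof. exact: (derivable_axiom a b ⊥ A1). Qed.
Lemma orr a b : b ≼ a ∨ b. Proof. exact: (derivable_axiom a b ⊥ A2). Qed.
Lemma andl a b : a ∧ b ≼ a. Proof. exact: (derivable_axiom a b ⊥ A4). Qed.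
Lemma bot_le a : ⊥ ≼ a. Proof. exact: (derivable_axiom a ⊥ ⊥ A7). Qed.
Lemma derivable_top : ⊢ ⊤. Proof. exact: (derivable_axiom ⊥ ⊥ ⊥ A6). Qed.

Lemma or_le a b c : a ≼ c -> b ≼ c -> a ∨ b ≼ c.
Proof. by move=> ac bc; apply: smp bc (smp ac (derivable_axiom a b c A3)). Qed.

Lemma le_and a b c : c ≼ a -> c ≼ b -> c ≼ a ∧ b.
Proof. by move=> ca cb; apply: smp cb (smp ca (derivable_axiom a b c A5)). Qed.

Lemma curry a b c : a ∧ b ≼ c -> a ≼ (b →H c).
Proof. by move=> h; apply: smp h (derivable_axiom a b c A8). Qed.

Lemma uncurry a b c : a ≼ (b →H c) -> a ∧ b ≼ c.
Proof. by move=> h; apply: smp h (derivable_axiom a b c A9). Qed.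

Lemma weakening a b : ⊢ b -> a ≼ b.
Proof. by move=> hb; apply: smp hb (curry (andl b a)). Qed.

Lemma imp_substl a b c : a ≼ b -> b ≼ a -> (a → c) ≼ (b → c).
Proof. by move=> ab ba; apply: smp ba (smp ab (derivable_axiom a b c A10)). Qed.

Lemma imp_substr a b c : a ≼ b -> b ≼ a -> (c → b) ≼ (c → a).
Proof. by move=> ab ba; apply: smp ba (smp ab (derivable_axiom a b c A11)). Qed.

(** No scheme gives reflexivity directly.  As [a →H b] stands for
    [a → (a ∧ b)], it is [a →H ⊤] with [a ∧ ⊤] replaced by [a ∧ a]. *)
Lemma entails_refl a : a ≼ a.
Proof.
have aT : a ≼ ⊤ := weakening a derivable_top.
apply: smp aT (imp_substr a _ _); apply: le_and; try exact: andl.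
exact: weakening derivable_top.
Qed.
Hint Resolve entails_refl : core.

Lemma andr a b : a ∧ b ≼ b.
Proof. exact: uncurry (weakening _ (entails_refl b)). Qed.

Lemma andC_le a b : a ∧ b ≼ b ∧ a.
Proof. by apply: le_and; [exact: andr | exact: andl]. Qed.

Lemma le_andr a b c : b ≼ c -> a ∧ b ≼ c.
Proof. by move=> bc; exact: uncurry (weakening _ bc). Qed.

(** Transitivity is not available yet: only the projections, the introduction of a
    left conjunct into the antecedent and replacement under [→] are.  Hence the
    detour through swapped conjunctions to rewrite the antecedent, which
    occurs twice in [a → (a ∧ c)]. *)
Lemma entails_substl a b c : a ≼ b -> b ≼ a -> a ≼ c -> b ≼ c.
Proof.
move=> ab ba ac.
have h1 : ⊢ b → (a ∧ c) := smp ac (imp_substl _ ab ba).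
have h2 : ⊢ b → (c ∧ a) := smp h1 (imp_substr b (andC_le c a) (andC_le a c)).
have h3 : ⊢ b → (c ∧ b).
  by apply: smp h2 (imp_substr b _ _); apply: le_and;
    [exact: andl | exact: le_andr | exact: andl | exact: le_andr].
exact: smp h3 (imp_substr b (andC_le b c) (andC_le c b)).
Qed.

Lemma entails_trans b a c : a ≼ b -> b ≼ c -> a ≼ c.
Proof.
move=> ab bc; apply: (@entails_substl (a ∧ b)); first exact: andl.
  exact: le_and.
exact: le_andr.
Qed.

Lemma le_andl a b c : a ≼ c -> a ∧ b ≼ c.
Proof. exact: entails_trans (andl a b). Qed.

Lemma le_top a : a ≼ ⊤. Proof. exact: weakening derivable_top. Qed.

Lemma top_le a : ⊤ ≼ a <-> ⊢ a.
Proof. by split; [exact: smp derivable_top | exact: weakening]. Qed.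

Lemma neg_le a b : a ≼ b -> ∼ b ≼ ∼ a. Proof. exact: scp. Qed.

Lemma negBot_ge : ⊤ ≼ ∼ ⊥. Proof. exact: (derivable_axiom ⊥ ⊥ ⊥ A12). Qed.
Lemma negTop_le : ∼ ⊤ ≼ ⊥. Proof. exact: (derivable_axiom ⊥ ⊥ ⊥ A13). Qed.
Lemma negAnd_le a b : ∼ (a ∧ b) ≼ ∼ a ∨ ∼ b.
Proof. exact: (derivable_axiom a b ⊥ A14). Qed.

(** Replacement under [→] of formulas equivalent relative to a context [c]. *)
Lemma imp_substl_in c a b d :
  c ∧ a ≼ b -> c ∧ b ≼ a -> c ∧ (a → d) ≼ (b → d).
Proof.
move=> ab ba; apply: uncurry.
have h := entails_trans (curry ab) (derivable_axiom a b d A10).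
exact: entails_trans (le_and (entails_refl c) (curry ba)) (uncurry h).
Qed.

Lemma imp_substr_in c a b d :
  c ∧ a ≼ b -> c ∧ b ≼ a -> c ∧ (d → b) ≼ (d → a).
Proof.
move=> ab ba; apply: uncurry.
have h := entails_trans (curry ab) (derivable_axiom a b d A11).
exact: entails_trans (le_and (entails_refl c) (curry ba)) (uncurry h).
Qed.

(** Provable equivalence, a congruence. *)
Definition equiv a b := a ≼ b /\ b ≼ a.
Local Notation "a ≡ b" := (equiv a b) (at level 70).

Lemma equiv_refl a : a ≡ a. Proof. by []. Qed.
Lemma equiv_sym a b : a ≡ b -> b ≡ a. Proof. by case. Qed.
Lemma equiv_trans b a c : a ≡ b -> b ≡ c -> a ≡ c.
Proof. by move=> [? ?] [? ?]; split; apply: (@entails_trans b). Qed.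

Lemma equiv_or a b c d : a ≡ c -> b ≡ d -> a ∨ b ≡ c ∨ d.
Proof.
by move=> [ac ca] [bd db]; split; apply: or_le;
  [apply: entails_trans ac (orl _ _) | apply: entails_trans bd (orr _ _)
  |apply: entails_trans ca (orl _ _) | apply: entails_trans db (orr _ _)].
Qed.

Lemma equiv_and a b c d : a ≡ c -> b ≡ d -> a ∧ b ≡ c ∧ d.
Proof.
by move=> [ac ca] [bd db]; split; apply: le_and;
  by [apply: le_andl | apply: le_andr].
Qed.

Lemma equiv_imp a b c d : a ≡ c -> b ≡ d -> (a → b) ≡ (c → d).
Proof.
move=> [ac ca] [bd db]; apply: (@equiv_trans (c → b)); split;
  by [apply: imp_substl | apply: imp_substr].
Qed.

Lemma equiv_neg a b : a ≡ b -> ∼ a ≡ ∼ b.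
Proof. by move=> [ab ba]; split; apply: neg_le. Qed.

Lemma orC_equiv a b : a ∨ b ≡ b ∨ a.
Proof. by split; apply: or_le; by [apply: orl | apply: orr]. Qed.

Lemma orA_equiv a b c : a ∨ (b ∨ c) ≡ a ∨ b ∨ c.
Proof.
split.
  apply: or_le; first exact: entails_trans (orl _ _) (orl _ _).
  by apply: or_le; [exact: entails_trans (orr _ _) (orl _ _) | exact: orr].
apply: or_le; last exact: entails_trans (orr _ _) (orr _ _).
by apply: or_le; [exact: orl | exact: entails_trans (orl _ _) (orr _ _)].
Qed.

Lemma orK_equiv a b : a ∨ (a ∧ b) ≡ a.
Proof. by split; [apply: or_le => //; exact: andl | exact: orl]. Qed.

Lemma andC_equiv a b : a ∧ b ≡ b ∧ a.
Proof. by split; exact: andC_le. Qed.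

Lemma andA_equiv a b c : a ∧ (b ∧ c) ≡ a ∧ b ∧ c.
Proof.
split.
  by apply: le_and; [apply: le_and; [exact: andl | exact/le_andr/andl]
                    | exact/le_andr/andr].
by apply: le_and; [exact/le_andl/andl
                  | apply: le_and; [exact/le_andl/andr | exact: andr]].
Qed.

Lemma andK_equiv a b : a ∧ (a ∨ b) ≡ a.
Proof. by split; [exact: andl | apply: le_and => //; exact: orl]. Qed.

Lemma botor_equiv a : ⊥ ∨ a ≡ a.
Proof. by split; [apply: or_le => //; exact: bot_le | exact: orr]. Qed.

Lemma topand_equiv a : ⊤ ∧ a ≡ a.
Proof. by split; [exact: andr | apply: le_and => //; exact: le_top]. Qed.

Lemma and_imp_equiv a b : a ∧ (a → b) ≡ a ∧ b.
Proof.
have h1 : a ∧ b ≼ a ∧ b by [].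
have h2 : a ∧ (a ∧ b) ≼ b by apply: le_andr; exact: andr.
split; apply: le_and; try exact: andl.
  have h : a ∧ (a → b) ≼ (a →H b) := imp_substr_in _ h2 h1.
  exact: entails_trans (le_and h (andl _ _)) (uncurry (entails_refl _)).
have h : a ∧ (a →H b) ≼ (a → b) := imp_substr_in _ h1 h2.
apply: entails_trans h; apply: le_and; first exact: andl.
exact/curry/le_andl/andr.
Qed.

Lemma and_imp_and_equiv a b c : a ∧ (b → c) ≡ a ∧ ((a ∧ b) → (a ∧ c)).
Proof.
have h1 d : a ∧ d ≼ a ∧ d by [].
have h2 d : a ∧ (a ∧ d) ≼ d by apply: le_andr; exact: andr.
split; apply: le_and; try exact: andl.
  exact: entails_trans (le_and (andl _ _) (imp_substl_in c (h1 b) (h2 b)))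
                       (imp_substr_in (a ∧ b) (h2 c) (h1 c)).
exact: entails_trans (le_and (andl _ _) (imp_substl_in (a ∧ c) (h2 b) (h1 b)))
                     (imp_substr_in b (h1 c) (h2 c)).
Qed.

Lemma impxx_equiv a : (a → a) ≡ ⊤.
Proof.
split; first exact: le_top.
apply/top_le; apply: smp (entails_refl a) (imp_substr a _ (andl a a)).
exact: le_and.
Qed.

Lemma negBot_equiv : ∼ ⊥ ≡ ⊤. Proof. by split; [exact: le_top | exact: negBot_ge]. Qed.
Lemma negTop_equiv : ∼ ⊤ ≡ ⊥. Proof. by split; [exact: negTop_le | exact: bot_le]. Qed.

Lemma negAnd_equiv a b : ∼ (a ∧ b) ≡ ∼ a ∨ ∼ b.
Proof.
split; first exact: negAnd_le.
by apply: or_le; apply: neg_le; [exact: andl | exact: andr].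
Qed.

Lemma equiv_top a : a ≡ ⊤ <-> ⊢ a.
Proof. by split=> [[_ /top_le]|/top_le ?] //; split=> //; exact: le_top. Qed.


(** * The Lindenbaum algebra *)

Definition equivb a b : bool := `[< a ≡ b >].

Lemma equivb_refl : reflexive equivb.
Proof. by move=> a; apply/asboolP; exact: equiv_refl. Qed.

Lemma equivb_sym : symmetric equivb.
Proof. by move=> a b; apply/asboolP/asboolP; exact: equiv_sym. Qed.

Lemma equivb_trans : transitive equivb.
Proof. by move=> b a c /asboolP ab /asboolP bc; apply/asboolP; exact: equiv_trans bc. Qed.

Canonical equivb_equiv_rel := EquivRel equivb equivb_refl equivb_sym equivb_trans.

(** Formulas modulo provable equivalence. *)
Definition formula_class := {eq_quot equivb}.

Definition class_of (a : formula) : formula_class := \pi a.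
Definition representative (x : formula_class) : formula := repr x.

Lemma class_ofP a b : class_of a = class_of b <-> a ≡ b.
Proof. by split=> [/eqquotP/asboolP|ab] //; apply/eqquotP/asboolP. Qed.

Lemma representativeK x : class_of (representative x) = x.
Proof. exact: reprK. Qed.

Lemma representative_class a : representative (class_of a) ≡ a.
Proof. by apply/class_ofP; rewrite representativeK. Qed.

(** Operations act on chosen representatives; [class_of_or] and its
    companions show that the choice does not matter. *)
Definition lindenbaum : algebra :=
  @Algebra formula_class
    (fun x y => class_of (representative x ∨ representative y))
    (fun x y => class_of (representative x ∧ representative y))
    (fun x y => class_of (representative x → representative y))
    (fun x => class_of (∼ representative x))
    (class_of ⊥) (class_of ⊤).

Lemma class_of_or a b :
  class_of (a ∨ b) = join (class_of a : lindenbaum) (class_of b).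
Proof. by apply/class_ofP/equiv_or; apply/equiv_sym/representative_class. Qed.

Lemma class_of_and a b :
  class_of (a ∧ b) = meet (class_of a : lindenbaum) (class_of b).
Proof. by apply/class_ofP/equiv_and; apply/equiv_sym/representative_class. Qed.

Lemma class_of_imp a b :
  class_of (a → b) = imp (class_of a : lindenbaum) (class_of b).
Proof. by apply/class_ofP/equiv_imp; apply/equiv_sym/representative_class. Qed.

Lemma class_of_neg a : class_of (∼ a) = neg (class_of a : lindenbaum).
Proof. by apply/class_ofP/equiv_neg/equiv_sym/representative_class. Qed.

Lemma eval_lindenbaum s a :
  eval (fun n => class_of (s n) : lindenbaum) a = class_of (subst s a).
Proof.
elim: a => [n|a IHa b IHb|a IHa b IHb|a IHa b IHb|a IHa||] //.
- by rewrite [subst _ _]/= class_of_or -IHa -IHb.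
- by rewrite [subst _ _]/= class_of_and -IHa -IHb.
- by rewrite [subst _ _]/= class_of_imp -IHa -IHb.
- by rewrite [subst _ _]/= class_of_neg -IHa.
Qed.

Lemma class_of_surj (x : lindenbaum) : exists a, x = class_of a.
Proof. by exists (representative x); rewrite representativeK. Qed.

Lemma lindenbaum_DHMSH : DHMSH lindenbaum.
Proof.
have E := (class_of_or, class_of_and, class_of_imp, class_of_neg).
split; [split; [split; split|..]|..].
- move=> x y; have [a ->] := class_of_surj x; have [b ->] := class_of_surj y.
  by rewrite -!E; apply/class_ofP/orC_equiv.
- move=> x y z; have [a ->] := class_of_surj x.
  have [b ->] := class_of_surj y; have [c ->] := class_of_surj z.
  by rewrite -!E; apply/class_ofP/orA_equiv.
- move=> x y; have [a ->] := class_of_surj x; have [b ->] := class_of_surj y.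
  by rewrite -!E; apply/class_ofP/orK_equiv.
- move=> x y; have [a ->] := class_of_surj x; have [b ->] := class_of_surj y.
  by rewrite -!E; apply/class_ofP/andC_equiv.
- move=> x y z; have [a ->] := class_of_surj x.
  have [b ->] := class_of_surj y; have [c ->] := class_of_surj z.
  by rewrite -!E; apply/class_ofP/andA_equiv.
- move=> x y; have [a ->] := class_of_surj x; have [b ->] := class_of_surj y.
  by rewrite -!E; apply/class_ofP/andK_equiv.
- move=> x; have [a ->] := class_of_surj x.
  by rewrite -E; apply/class_ofP/botor_equiv.
- move=> x; have [a ->] := class_of_surj x.
  by rewrite -E; apply/class_ofP/topand_equiv.
- move=> x y; have [a ->] := class_of_surj x; have [b ->] := class_of_surj y.
  by rewrite -!E; apply/class_ofP/and_imp_equiv.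
- move=> x y z; have [a ->] := class_of_surj x.
  have [b ->] := class_of_surj y; have [c ->] := class_of_surj z.
  by rewrite -!E; apply/class_ofP/and_imp_and_equiv.
- move=> x; have [a ->] := class_of_surj x.
  by rewrite -E; apply/class_ofP/impxx_equiv.
- by rewrite -class_of_neg; apply/class_ofP/negBot_equiv.
- by rewrite -class_of_neg; apply/class_ofP/negTop_equiv.
- move=> x y; have [a ->] := class_of_surj x; have [b ->] := class_of_surj y.
  by rewrite -!E; apply/class_ofP/negAnd_equiv.
Qed.

End Derivations.

(** * Theorems, models and completeness *)

Lemma subst_subst s t a : subst s (subst t a) = subst (fun n => subst s (t n)) a.
Proof. by elim: a => //= [a -> b ->|a -> b ->|a -> b ->|a ->]. Qed.

Lemma subst_Var a : subst Var a = a.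
Proof. by elim: a => //= [a -> b ->|a -> b ->|a -> b ->|a ->]. Qed.

Lemma theorem_subst S s a : theorem_of (hilbert S) a -> theorem_of (hilbert S) (subst s a).
Proof.
elim=> [//|_ [b [t [Sb ->]]]|b c _ hb _ hbc|b c _ hbc].
- by apply: ax; exists b, (fun n => subst s (t n)); rewrite subst_subst.
- exact: smp hb hbc.
- exact: scp hbc.
Qed.

(** Consequence from premises depends on the schemes only through the
    theorems. *)
Lemma sub_hilbert S T G a : (forall b, S b -> theorem_of (hilbert T) b) ->
  hilbert S G a -> hilbert T G a.
Proof.
have weak b : theorem_of (hilbert T) b -> hilbert T G b.
  elim=> [//|*|c d _ hc _|c d _]; [exact: ax | exact: smp hc | exact: scp].
move=> ST; elim=> [b|_ [b [t [Sb ->]]]|b c _ hb _|b c _].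
- exact: hyp.
- exact/weak/theorem_subst/ST.
- exact: smp hb.
- exact: scp.
Qed.

Lemma axiom_theorem S a : S a -> theorem_of (hilbert S) a.
Proof. by move=> Sa; apply: ax; exists a, Var; rewrite subst_Var. Qed.

Section Completeness.
Variable S : schemes.
Hypothesis subS : forall a, DHMSH_schemes a -> S a.

Lemma lindenbaum_models :
  models (hilbert S) (lindenbaum (fun _ => False) subS).
Proof.
split=> [|a Sa v]; first exact: lindenbaum_DHMSH.
have -> : v = fun n => class_of (fun _ => False) subS (representative (v n)).
  by apply/funext => n; rewrite representativeK.
by rewrite eval_lindenbaum; apply/class_ofP/equiv_top/theorem_subst.
Qed.

Lemma theorem_complete a :
  (forall A, models (hilbert S) A -> satisfies_one A a) -> theorem_of (hilbert S) a.
Proof.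
move=> /(_ _ lindenbaum_models (fun n => class_of _ subS (Var n))).
by rewrite eval_lindenbaum subst_Var => /class_ofP/equiv_top; exact.
Qed.

End Completeness.

Lemma same_models_same_logic S T :
  (forall a, DHMSH_schemes a -> S a) -> (forall a, DHMSH_schemes a -> T a) ->
  same_class (models (hilbert S)) (models (hilbert T)) ->
  same_logic (hilbert S) (hilbert T).
Proof.
move=> subS subT ST G a; split; apply: sub_hilbert => b b_ax.
  apply: theorem_complete => // A /ST [_]; apply.
  exact: axiom_theorem.
apply: theorem_complete => // A /ST [_]; apply.
exact: axiom_theorem.
Qed.

(** * The variety generated by the two two-element algebras *)

(** [A] satisfies the identity [s ≈ t]. *)
Definition identity (A : algebra) (s t : formula) : Prop :=
  forall v : nat -> A, eval v s = eval v t.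

Lemma hom_eval (A B : algebra) (f : A -> B) v a :
  hom f -> f (eval v a) = eval (fun n => f (v n)) a.
Proof.
case=> fj fm fi fn [f0 f1].
by elim: a => //= [a <- b <-|a <- b <-|a <- b <-|a <-].
Qed.

Lemma eval_product (I : Type) (B : I -> algebra) (v : nat -> product_algebra B) a i :
  eval v a i = eval (fun n => v n i) a.
Proof. by elim: a => //= [a -> b ->|a -> b ->|a -> b ->|a ->]. Qed.

Lemma identity_variety s t : variety (fun A => identity A s t).
Proof.
split=> [A B f st hf surjf v|A B f st hf injf v|I B st v].
- have [w fw] := choice (fun n => surjf (v n)).
  have -> : v = fun n => f (w n) by apply/funext => n; rewrite fw.
  by rewrite -!(hom_eval _ _ hf) st.
- by apply: injf; rewrite !(hom_eval _ _ hf) st.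
- apply: functional_extensionality_dep => i.
  by rewrite !eval_product st.
Qed.

Lemma generated_identity A s t : generated_variety two_element_pair A ->
  identity two_e s t -> identity two_bar_e s t -> identity A s t.
Proof.
move=> /(_ _ (identity_variety s t)) hA h1 h2; apply: hA.
by move=> B [|] ->.
Qed.

(** Both generators at once: [two true] is [two_e], [two false] is [two_bar_e],
    and [e] is the value of [0 -> 1]. *)
Definition two (e : bool) : algebra :=
  @Algebra bool orb andb (if e then fun x y => x ==> y else fun x y => x == y)
    negb false true.

Lemma eval_subst (A : algebra) (v : nat -> A) s a :
  eval v (subst s a) = eval (fun n => eval v (s n)) a.
Proof. by elim: a => //= [a -> b ->|a -> b ->|a -> b ->|a ->]. Qed.

Lemma soundness_two e S a : (forall s, S s -> satisfies_one (two e) s) ->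
  theorem_of (hilbert S) a -> satisfies_one (two e) a.
Proof.
move=> S1 + v; elim=> [//|_ [b [s [Sb ->]]]|b c _ + _|b c _] /=.
- by rewrite eval_subst; exact: S1.
- by case: e {S1} v => v /= ->; case: (eval v c).
- by case: e {S1} v => v /=; case: (eval v b); case: (eval v c).
Qed.

Lemma classical_schemes_two e s :
  adjoin DQDSH_schemes boolean_scheme s -> satisfies_one (two e) s.
Proof.
by case=> [[]|] [] v; case: e v => v /=; case: (v 0) => //; case: (v 1) => //;
  case: (v 2).
Qed.

Lemma generated_DHMSH A : generated_variety two_element_pair A -> DHMSH A.
Proof.
move=> genA; pose x := Var 0; pose y := Var 1; pose z := Var 2.
have transfer s t (h : forall e, identity (two e) s t) (a b c : A) :
    eval (nth a [:: a; b; c]) s = eval (nth a [:: a; b; c]) t.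
  exact: generated_identity genA (h true) (h false) _.
(* Each defining identity is verified on truth values. *)
split; [split; [split; split|..]|..].
- by move=> a b; apply: (transfer (Or x y) (Or y x) _ a b a) => e v /=;
    case: (v 0); case: (v 1).
- by move=> a b c; apply: (transfer (Or x (Or y z)) (Or (Or x y) z)) => e v /=;
    case: (v 0); case: (v 1).
- by move=> a b; apply: (transfer (Or x (And x y)) x _ a b a) => e v /=;
    case: (v 0); case: (v 1).
- by move=> a b; apply: (transfer (And x y) (And y x) _ a b a) => e v /=;
    case: (v 0); case: (v 1).
- by move=> a b c; apply: (transfer (And x (And y z)) (And (And x y) z)) => e v /=;
    case: (v 0); case: (v 1).
- by move=> a b; apply: (transfer (And x (Or x y)) x _ a b a) => e v /=;
    case: (v 0); case: (v 1).
- by move=> a; apply: (transfer (Or Bot x) x _ a a a).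
- by move=> a; apply: (transfer (And Top x) x _ a a a).
- by move=> a b; apply: (transfer (And x (Imp x y)) (And x y) _ a b a) => -[] v /=;
    case: (v 0); case: (v 1).
- by move=> a b c; apply: (transfer (And x (Imp y z))
    (And x (Imp (And x y) (And x z)))) => -[] v /=; case: (v 0); case: (v 1).
- by move=> a; apply: (transfer (Imp x x) Top _ a a a) => -[] v /=; case: (v 0).
- exact: (transfer (Neg Bot) Top _ zero zero zero).
- exact: (transfer (Neg Top) Bot _ zero zero zero).
- by move=> a b; apply: (transfer (Neg (And x y)) (Or (Neg x) (Neg y)) _ a b a)
    => e v /=; case: (v 0).
Qed.

Lemma generated_models A : generated_variety two_element_pair A ->
  models (hilbert (adjoin DQDSH_schemes boolean_scheme)) A.
Proof.
move=> genA; split=> [|a ha v]; first exact: generated_DHMSH.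
have sound e := soundness_two (@classical_schemes_two e) ha.
exact: (generated_identity (t := Top) genA (sound true) (sound false)).
Qed.

(** * Boolean algebras as subdirect products of two-element algebras *)

Section Representation.
Variable A : algebra.
Hypothesis DA : DHMSH A.
Implicit Types x y z : A.

Let joinmeetK x y : join x (meet x y) = x. Proof. by case: DA => [] [] [] []. Qed.
Let meetC : commutative (@meet A). Proof. by case: DA => [] [] [] _ []. Qed.
Let meetA : associative (@meet A). Proof. by case: DA => [] [] [] _ []. Qed.
Let meetjoinK x y : meet x (join x y) = x. Proof. by case: DA => [] [] [] _ []. Qed.
Let join0x : left_id zero (@join A). Proof. by case: DA => [] [] [] _ _ []. Qed.
Let meet1x : left_id one (@meet A). Proof. by case: DA => [] [] [] _ _ []. Qed.
Let meet_imp x y : meet x (imp x y) = meet x y. Proof. by case: DA => [] []. Qed.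
Let meet_imp_meet x y z :
  meet x (imp y z) = meet x (imp (meet x y) (meet x z)).
Proof. by case: DA => [] []. Qed.
Let impxx x : imp x x = one. Proof. by case: DA => [] []. Qed.
Let neg0 : neg (zero : A) = one. Proof. by case: DA. Qed.
Let negI x y : neg (meet x y) = join (neg x) (neg y). Proof. by case: DA. Qed.

Let meetxx x : meet x x = x. Proof. by rewrite -{2}(joinmeetK x x) meetjoinK. Qed.
Let meet0x x : meet zero x = zero. Proof. by rewrite -{1}(join0x x) meetjoinK. Qed.
Let meetx0 x : meet x zero = zero. Proof. by rewrite meetC. Qed.
Let meetx1 x : meet x one = x. Proof. by rewrite meetC. Qed.

(** From [p ∧ q = 1] both conjuncts are [1], and [x →H y = 1] gives [x ∧ y = x]. *)
Lemma boolean_scheme_imp0 : satisfies_one A (((∼ Var 0) → ⊥) ⇔H Var 0)%F ->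
  forall x, imp (neg x) zero = x.
Proof.
move=> ax x; have /= {ax} := ax (fun _ => x); set n := imp (neg x) zero.
set p := imp n _; set q := imp x _ => pq1.
have p1 : p = one by rewrite -(meetx1 p) -pq1 meetA meetxx.
have q1 : q = one by rewrite -(meetx1 q) -pq1 meetC -meetA meetxx.
have nx : meet n x = n by rewrite -[RHS]meetx1 -p1 meet_imp meetA meetxx.
by rewrite -nx meetC -[RHS]meetx1 -q1 meet_imp meetA meetxx.
Qed.

(* From here on [x'* = x] is assumed. *)
Hypothesis imp0_neg : forall x, imp (neg x) zero = x.

(* The pseudocomplement. *)
Local Notation pseudo x := (imp x zero).

Let meet_pseudo x : meet x (pseudo x) = zero. Proof. by rewrite meet_imp. Qed.

Let le_pseudo x y : meet x y = zero -> meet x (pseudo y) = x.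
Proof. by move=> xy0; rewrite meet_imp_meet xy0 meetx0 impxx. Qed.

Lemma pseudo3 x : pseudo (pseudo (pseudo x)) = pseudo x.
Proof.
have h : meet x (pseudo (pseudo x)) = x by exact: le_pseudo.
have h1 : meet (pseudo x) (pseudo (pseudo (pseudo x))) = pseudo x by exact: le_pseudo.
rewrite -[RHS]h1 meetC; apply/esym/le_pseudo.
set t := pseudo (pseudo x) in h *.
by rewrite -h (meetC x) meetA (meetC _ t) meet_pseudo meet0x.
Qed.

Lemma neg_pseudo x : neg x = pseudo x.
Proof. by rewrite -[LHS]imp0_neg -pseudo3 !imp0_neg. Qed.

Lemma meet_neg x : meet x (neg x) = zero. Proof. by rewrite neg_pseudo. Qed.

Lemma negK : involutive (@neg A).
Proof. by move=> x; rewrite neg_pseudo imp0_neg. Qed.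

Lemma le_neg x y : meet x y = zero -> meet x (neg y) = x.
Proof. by rewrite neg_pseudo; exact: le_pseudo. Qed.

(** Ultrafilters, given by their characteristic functions: preserving meet and
    complement is enough, since it implies preservation of [0], [1] and join. *)
Definition ultrafilter (h : A -> bool) : Prop :=
  {morph h : x y / meet x y >-> x && y} /\ {morph h : x / neg x >-> ~~ x}.

Lemma ultrafilter_exists a : a <> zero -> exists2 h, ultrafilter h & h a.
Proof.
move=> a0.
(* The empty set has to satisfy [P], as the union of the empty chain.  So [a]
   is not required to lie in [F], only to be compatible with its elements. *)
pose P (F : set A) := [/\ forall x y, F x -> F y -> F (meet x y),
  forall x y, F x -> meet x y = x -> F y & forall x, F x -> meet x a <> zero].
have [F [[FI Fup Fa] Fmax]] : exists F, P F /\ forall H, (F `<` H)%classic -> ~ P H.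
  apply: Zorn_bigcup => C CP Ctot;
    split=> [x y [X CX Xx] [Y CY Yy]|x y [X CX Xx] xy|x [X CX Xx]].
  - have [XY|YX] := Ctot _ _ CX CY.
      by exists Y => //; have [h _ _] := CP _ CY; apply: h => //; apply: XY.
    by exists X => //; have [h _ _] := CP _ CX; apply: h => //; apply: YX.
  - by exists X => //; have [_ h _] := CP _ CX; apply: h Xx xy.
  - by have [_ _ h] := CP _ CX; apply: h.
(* By maximality, adding [x] to [F] gives a filter incompatible with [a]; the
   case [f = one] covers the possibility that [F] is empty. *)
have Fext x : ~ F x -> exists2 f, F f \/ f = one & meet (meet f x) a = zero.
  move=> nFx; apply: contrapT => no.
  pose H z := exists2 f, F f \/ f = one & meet (meet f x) z = meet f x.
  apply: (Fmax H); first split.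
  - by move=> f Ff; exists f; [left | rewrite (meetC f) -meetA meetxx].
  - move=> HF; apply/nFx/HF; exists one; first by right.
    by rewrite meet1x meetxx.
  split=> [y z [f Ff fy] [g Fg gz]|y z [f Ff fy] yz|y [f Ff fy] ya].
  - exists (meet f g).
      case: Ff Fg => [Ff|->] [Fg|->]; rewrite ?meet1x ?meetx1;
        [by left; exact: FI | by left | by left | by right].
    have -> : meet (meet f g) x = meet (meet f x) (meet g x).
      by rewrite -!meetA (meetA x) (meetC x) -(meetA g) meetxx.
    by rewrite -{2}fy -{2}gz -!meetA; congr meet; congr meet; rewrite !meetA; congr meet;
       rewrite (meetC y) -!meetA (meetC y).
  - by exists f => //; rewrite -fy -meetA yz.
  - by apply: no; exists f => //; rewrite -fy -meetA ya meetx0.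
have F1 : F one.
  apply: contrapT => /Fext [f Ff]; rewrite meetx1; case: Ff => [/Fa //|->].
  by rewrite meet1x.
have Fext' x : ~ F x -> exists2 f, F f & meet (meet f x) a = zero.
  by move=> /Fext [f Ff fx]; exists f => //; case: Ff => // ->.
have FA : F a.
  by apply: contrapT => /Fext' [f /Fa fa]; rewrite -meetA meetxx.
have Fneg x : ~ F x -> F (neg x).
  move=> /Fext' [f Ff fxa]; apply: (Fup (meet f a)); first exact: FI.
  by apply: le_neg; rewrite -meetA (meetC a) meetA.
exists (fun x => `[< F x >]); last exact/asboolP.
split=> [x y|x].
  apply/asboolP/andP => [Fxy|[/asboolP Fx /asboolP Fy]]; last exact: FI.
  split; apply/asboolP; apply: Fup Fxy _.
    by rewrite -meetA (meetC y) meetA meetxx.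
  by rewrite -meetA meetxx.
apply/asboolP/asboolPn => [Fnx Fx|]; last exact: Fneg.
by apply: (Fa _ (FI _ _ Fx Fnx)); rewrite meet_neg meet0x.
Qed.

Section Character.
Variable h : A -> bool.
Hypothesis uh : ultrafilter h.

Let h_meet : {morph h : x y / meet x y >-> x && y}. Proof. by case: uh. Qed.
Let h_neg : {morph h : x / neg x >-> ~~ x}. Proof. by case: uh. Qed.

Lemma ultrafilter0 : h zero = false.
Proof. by rewrite -(meet_neg zero) h_meet h_neg andbN. Qed.

Lemma ultrafilter1 : h one = true.
Proof. by rewrite -neg0 h_neg ultrafilter0. Qed.

Lemma ultrafilter_join : {morph h : x y / join x y >-> x || y}.
Proof.
by move=> x y; rewrite -{1}(negK x) -{1}(negK y) -negI h_neg h_meet !h_neg -negb_or negbK.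
Qed.

(** If [h x] holds, use [x ∧ (x -> y) = x ∧ y].  Otherwise take [w] to be
    [x' ∧ y] or [x' ∧ y'], whichever satisfies [h w]; then [x -> y] may be
    computed below [w], by [w ∧ (x -> y) = w ∧ ((w ∧ x) -> (w ∧ y))].  The right
    side involves [0 -> w] in the first case, again computable from [0 -> 1]
    below [w], and [0 -> 0] in the second. *)
Lemma ultrafilter_imp x y :
  h (imp x y) = @imp (two (h (imp zero one))) (h x) (h y).
Proof.
have rel w u v : h w -> h (imp u v) = h (imp (meet w u) (meet w v)).
  move=> hw; have := congr1 h (meet_imp_meet w u v).
  by rewrite !h_meet hw.
case hx : (h x).
  have := congr1 h (meet_imp x y); rewrite !h_meet hx /= => ->.
  by case: (h (imp zero one)); case: (h y).
have hnx : h (neg x) by rewrite h_neg hx.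
case hy : (h y).
  pose w := meet (neg x) y.
  have hw : h w by rewrite h_meet hnx hy.
  rewrite (rel w x y hw).
  have -> : meet w x = zero by rewrite -meetA (meetC y) meetA (meetC _ x) meet_neg meet0x.
  have -> : meet w y = w by rewrite -meetA meetxx.
  have := rel w zero one hw; rewrite meetx0 meetx1 => <-.
  by case: (h (imp zero one)).
pose w := meet (neg x) (neg y).
have hw : h w by rewrite h_meet hnx h_neg hy.
rewrite (rel w x y hw).
have -> : meet w x = zero.
  by rewrite -meetA (meetC (neg y)) meetA (meetC _ x) meet_neg meet0x.
have -> : meet w y = zero by rewrite -meetA (meetC (neg y)) meet_neg meetx0.
by rewrite impxx ultrafilter1; case: (h (imp zero one)).
Qed.

End Character.

Lemma ultrafilter_separation x y :
  (forall h, ultrafilter h -> h x = h y) -> x = y.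
Proof.
have le u v : (forall h, ultrafilter h -> h u = h v) -> meet u v = u.
  move=> huv; rewrite -{1}(negK v); apply: le_neg; apply: contrapT.
  move=> /ultrafilter_exists [h uh]; case: (uh) => hM hN.
  by rewrite hM hN (huv h uh) andbN.
by move=> hxy; rewrite -(le x y) // meetC (le y x) // => h /hxy ->.
Qed.

Lemma boolean_generated : generated_variety two_element_pair A.
Proof.
move=> V [_ Vsub Vprod] Vgen.
pose I := {h : A -> bool | ultrafilter h}.
pose B (i : I) := two (sval i (imp zero one)).
apply: (Vsub (product_algebra B) A (fun x i => sval i x)).
- apply: Vprod => i; rewrite /B; case: (sval i _); apply: Vgen; [by left | by right].
- split; [move=> x y|move=> x y|move=> x y|move=> x|split];
    apply: functional_extensionality_dep => -[h uh] /=.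
  + exact: ultrafilter_join.
  + by case: uh.
  + exact: ultrafilter_imp.
  + by case: uh.
  + exact: ultrafilter0.
  + exact: ultrafilter1.
- move=> x y xy; apply: ultrafilter_separation => h uh.
  exact: (congr1 (fun f => f (exist _ h uh)) xy).
Qed.

End Representation.

(** * The logic of the two two-element algebras *)

Theorem corollary7p1 :
  corresponding_logic (generated_variety two_element_pair)
    (hilbert (adjoin DQDSH_schemes boolean_scheme)).
Proof.
have V_models : same_class (generated_variety two_element_pair)
    (models (hilbert (adjoin DQDSH_schemes boolean_scheme))).
  move=> A; split=> [|[DA thmA]]; first exact: generated_models.
  apply: boolean_generated => //; apply: boolean_scheme_imp0 => //.
  by apply/thmA/axiom_theorem; right.
split=> // [|M [T MT] VM].
  exists (adjoin DQD_schemes boolean_scheme) => G a.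
  split; apply: sub_hilbert => b b_ax; apply: axiom_theorem; move: b_ax.
    by case=> [[?|?]|?]; [left | right; left | right; right].
  by case=> [?|[?|?]]; [left; left | left; right | right].
have same : same_logic (hilbert (adjoin DHMSH_schemes T))
    (hilbert (adjoin DQDSH_schemes boolean_scheme)).
  apply: same_models_same_logic => [a|a|A]; [by left|by left; left|].
  rewrite -V_models VM; split=> -[DA thmA]; split=> // a /MT; exact: thmA.
by move=> G a; rewrite MT.
Qed.
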